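(* (Deductive interpolation) For any formulas $A$ and $B$, if $\Rightarrow A \ \vdash_{\mathbf{iK_d^{+}}}\ \Rightarrow B$ then there exists a formula $C$ such that: - $\Rightarrow A \ \vdash_{\mathbf{iK_d^{+}}} \ \Rightarrow C$, - $\Rightarrow C \ \vdash_{\mathbf{iK_d^{+}}} \ \Rightarrow B$, and - $V(C) \subseteq V(A) \cap V(B)$.
   Context: Language and sequents. Fix a set $V$ of atomic propositions. $\mathcal{L}$-formulas (simply ''formulas'') are built from atoms in $V$ and the constants $\top,\bot$ using binary connectives $\wedge,\vee,\supset,\to$ and the unary connective $\nabla$. $V(A)$ is the set of atoms occurring in $A$. $\nabla^n A$ is the $n$-fold application of $\nabla$ to $A$, and $\nabla^n\Gamma$ is the multiset $\{\nabla^n A \mid A\in\Gamma\}$. A sequent is an expression $\Gamma\Rightarrow\Delta$ with $\Gamma,\Delta$ finite multisets of formulas, $\Delta$ containing at most one formula. Comma is multiset union; a formula stands for its singleton. Calculus $\mathbf{iK_d}$. Rules are written ''premises / conclusion''; $\Gamma,\Sigma$ are arbitrary finite multisets, $\Delta$ has at most one formula, $A,B$ are arbitrary formulas, $n\ge 0$ is an arbitrary natural number. Axioms: $(Id^p)$ $p\Rightarrow p$ for $p$ an atom; $(L\bot)$ $\bot\Rightarrow$; $(R\top)$ $\Rightarrow\top$. $(LW)$ $\Gamma\Rightarrow\Delta$ / $\Gamma,\Sigma\Rightarrow\Delta$. $(Rw)$ $\Gamma\Rightarrow$ / $\Gamma\Rightarrow A$. $(L\wedge^n)$ $\Gamma,\nabla^nA,\nabla^nB\Rightarrow\Delta$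 / $\Gamma,\nabla^n(A\wedge B)\Rightarrow\Delta$. $(R\wedge)$ $\Gamma\Rightarrow A$ and $\Gamma\Rightarrow B$ / $\Gamma\Rightarrow A\wedge B$. $(L\vee^n)$ $\Gamma,\nabla^nA\Rightarrow\Delta$ and $\Gamma,\nabla^nB\Rightarrow\Delta$ / $\Gamma,\nabla^n(A\vee B)\Rightarrow\Delta$. $(R\vee_1)$ $\Gamma\Rightarrow A$ / $\Gamma\Rightarrow A\vee B$. $(R\vee_2)$ $\Gamma\Rightarrow B$ / $\Gamma\Rightarrow A\vee B$. $(L\to^n)$ $\Gamma,\nabla^{n+1}(A\to B)\Rightarrow\nabla^nA$ and $\Gamma,\nabla^{n+1}(A\to B),\nabla^nB\Rightarrow\Delta$ / $\Gamma,\nabla^{n+1}(A\to B)\Rightarrow\Delta$. $(R\to)$ $\nabla\Gamma,A\Rightarrow B$ / $\Gamma\Rightarrow A\to B$. $(L\supset^n)$ $\Gamma,\nabla^n(A\supset B)\Rightarrow\nabla^nA$ and $\Gamma,\nabla^nB\Rightarrow\Delta$ / $\Gamma,\nabla^n(A\supset B)\Rightarrow\Delta$. $(R\supset)$ $\Gamma,A\Rightarrow B$ / $\Gamma\Rightarrow A\supset B$. $(N)$ $\Gamma\Rightarrow\Delta$ / $\nabla\Gamma\Rightarrow\nabla\Delta$. $\mathbf{iK_d^{+}}$ is $\mathbf{iK_d}$ extended by the rule $(cut)$: $\Gamma\Rightarrow A$ and $\Sigma,A\Rightarrow\Delta$ / $\Sigma,\Gamma\Rightarrow\Delta$. For sequents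 $S',S$ and a calculus $G$, $S'\vdash_G S$ means that there is a proof-tree for $S$ built with the rules of $G$ whose leaves are axioms of $G$ or the sequent $S'$ (used as an assumption any number of times). *)

(* Defs.v *)
From Stdlib Require Import List Permutation.
Import ListNotations.

Set Implicit Arguments.

Inductive formula (V : Type) : Type :=
| Atom (p : V)
| Top
| Bot
| And (A B : formula V)
| Or (A B : formula V)
| Impl (A B : formula V)  (* intuitionistic implication, A ⊃ B *)
| Arrow (A B : formula V) (* A → B *)
| Nabla (A : formula V).

Arguments Top {V}.
Arguments Bot {V}.

Definition nabla {V : Type} (n : nat) (A : formula V) : formula V :=
  Nat.iter n (@Nabla V) A.

Fixpoint occurs {V : Type} (p : V) (A : formula V) : Prop :=
  match A with
  | Atom q => p = q
  | Top | Bot => False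
  | And B C | Or B C | Impl B C | Arrow B C => occurs p B \/ occurs p C
  | Nabla B => occurs p B
  end.

(* Antecedents are finite multisets, represented by lists up to [Permutation];
   the identification is made by [derives_mset] below.  Succedents contain at
   most one formula. *)
Record sequent (V : Type) : Type :=
  Sequent { ante : list (formula V); succ : option (formula V) }.

Definition seq_eq {V : Type} (S T : sequent V) : Prop :=
  Permutation (ante S) (ante T) /\ succ S = succ T.

Declare Scope sequent_scope.
Delimit Scope sequent_scope with seq.
Notation "G ==> D" := (Sequent G D)
  (at level 68, no associativity) : sequent_scope.
Local Open Scope sequent_scope.

(* A calculus is the relation between the premises and the conclusion of its
   rule instances; axioms are the instances without premises. *)
Definition calculus (V : Type) : Type := list (sequent V) -> sequent V -> Prop.

Inductive iKd {V : Type} : calculus V :=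
| Id (p : V) :
    iKd [] ([Atom p] ==> Some (Atom p))
| LBot :
    iKd [] ([Bot] ==> None)
| RTop :
    iKd [] ([] ==> Some Top)
| LW G S D :
    iKd [G ==> D] (G ++ S ==> D)
| RW G A :
    iKd [G ==> None] (G ==> Some A)
| LAnd n G A B D :
    iKd [nabla n A :: nabla n B :: G ==> D]
        (nabla n (And A B) :: G ==> D)
| RAnd G A B :
    iKd [G ==> Some A; G ==> Some B]
        (G ==> Some (And A B))
| LOr n G A B D :
    iKd [nabla n A :: G ==> D; nabla n B :: G ==> D]
        (nabla n (Or A B) :: G ==> D)
| ROr1 G A B :
    iKd [G ==> Some A] (G ==> Some (Or A B))
| ROr2 G A B :
    iKd [G ==> Some B] (G ==> Some (Or A B))
| LArrow n G A B D :
    iKd [nabla (S n) (Arrow A B) :: G ==> Some (nabla n A);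
         nabla (S n) (Arrow A B) :: nabla n B :: G ==> D]
        (nabla (S n) (Arrow A B) :: G ==> D)
| RArrow G A B :
    iKd [A :: map (@Nabla V) G ==> Some B]
        (G ==> Some (Arrow A B))
| LImpl n G A B D :
    iKd [nabla n (Impl A B) :: G ==> Some (nabla n A);
         nabla n B :: G ==> D]
        (nabla n (Impl A B) :: G ==> D)
| RImpl G A B :
    iKd [A :: G ==> Some B]
        (G ==> Some (Impl A B))
| N G D :
    iKd [G ==> D]
        (map (@Nabla V) G ==> option_map (@Nabla V) D).

Inductive iKdplus {V : Type} : calculus V :=
| iKdplus_base Ss T :
    iKd Ss T -> iKdplus Ss T
| Cut G S A D :
    iKdplus [G ==> Some A; A :: S ==> D] (S ++ G ==> D).

(* [derives R H S]: there is a proof tree for [S] in the calculus [R] whose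
   leaves are axioms of [R] or the assumption [H]. *)
Inductive derives {V : Type} (R : calculus V) (H : sequent V) :
    sequent V -> Prop :=
| derives_hyp :
    derives R H H
| derives_rule Ss T :
    R Ss T -> (forall S, In S Ss -> derives R H S) -> derives R H T
| derives_mset S T :
    seq_eq S T -> derives R H S -> derives R H T.

(* Main.v *)
Require Import Defs.
From Stdlib Require Import List.
Import ListNotations.
From Stdlib Require Import Permutation Classical.
From mathcomp Require classical_sets.
Local Open Scope sequent_scope.

(** The proof is semantic: if no interpolant exists, two theories amalgamate
    into one Kripke model in which [A] holds everywhere and [B] fails
    somewhere.

    Modulo derivability, formulas form a Heyting algebra in which [Nabla]
    preserves finite meets and [Arrow] is its residual: [Nabla c /\ a <= b] iff
    [c <= Arrow a b], just as [c /\ a <= b] iff [c <= Impl a b]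
    ([derives_algebra]). Dually, [Nabla] is the preimage along a monotone map
    [f] of a preorder: [w] forces [Nabla a] iff [f w] forces [a], and [w]
    forces [Arrow a b] iff every [v] with [w <= f v] that forces [a] forces
    [b]. The calculus with cut is sound for these models, also relative to an
    assumption true at all worlds ([derives_sound]).

    Given [A] and [B], let [T] be the set of the formulas in the common
    vocabulary that follow from [A]. Any member of [T] from which [B] follows
    is an interpolant. Suppose there is none. Take as worlds the pairs of a
    prime filter of the order of derivability from [A] and a prime filter of
    the order of derivability from members of [T], both filters containing the
    same formulas of the common vocabulary; order the pairs by inclusion and
    let [f] be the preimage under [Nabla] in both components. A formula over
    the vocabulary of [A] is forced exactly where the first component contains
    it, one over the vocabulary of [B] exactly where the second does
    ([forces_left], [forces_right]).

    The crux is that the witnesses required by [Impl] and [Arrow] exist as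
    pairs. A prime filter in one component is found in the usual way, and
    [transfer] completes it by one in the other: the only obstruction would be
    an implication between common formulas that one component contains and the
    other refutes, and that implication is itself a common formula. Both
    connectives are treated at once, since only residuation is used
    ([residual_extension]).

    Every world forces [A], because its first component contains all formulas
    derivable from [A]; by soundness every world forces [B]. But a prime filter
    of the second kind that omits [B] exists by assumption, and by [transfer]
    it is the second component of a world: a contradiction. *)

(** * Kripke semantics *)

Section Semantics.

Context {V W : Type} (R : W -> W -> Prop) (f : W -> W) (val : V -> W -> Prop).

Fixpoint forces (w : W) (a : formula V) : Prop :=
  match a with
  | Atom p => val p w
  | Top => True
  | Bot => False
  | And a b => forces w a /\ forces w b
  | Or a b => forces w a \/ forces w b
  | Impl a b => forall v, R w v -> forces v a -> forces v b
  | Arrow a b => forall v, R w (f v) -> forces v a -> forces v b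
  | Nabla a => forces (f w) a
  end.

Definition forces_succ (w : W) (D : option (formula V)) : Prop :=
  match D with Some a => forces w a | None => False end.

Definition valid (S : sequent V) : Prop :=
  forall w, Forall (forces w) (ante S) -> forces_succ w (succ S).

Lemma forces_nabla n w a : forces w (nabla n a) <-> forces (Nat.iter n f w) a.
Proof.
  revert w; induction n as [|n IH]; intros w; simpl; [tauto|].
  change (forces (f w) (nabla n a) <-> forces (f (Nat.iter n f w)) a).
  rewrite IH, <- PeanoNat.Nat.iter_succ_r; reflexivity.
Qed.

Hypothesis R_refl : forall w, R w w.
Hypothesis R_trans : forall u v w, R u v -> R v w -> R u w.
Hypothesis f_mono : forall v w, R v w -> R (f v) (f w).
Hypothesis val_mono : forall p v w, R v w -> val p v -> val p w.

Lemma forces_mono a v w : R v w -> forces v a -> forces w a.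
Proof.
  revert v w; induction a; simpl; intros v w Hvw; eauto; intuition eauto.
Qed.

(** The prefix [nabla n] only moves the evaluation to the [n]-th iterate of [f]
    ([forces_nabla]), so the left rules reduce to their instances without
    prefix; for [RArrow], if [w <= f v] then [v] forces [Nabla c] for each [c]
    in the context, by persistence. *)
Lemma rule_sound Ss T :
  iKdplus Ss T -> (forall S, In S Ss -> valid S) -> valid T.
Proof.
  unfold valid; intros HR HS w.
  destruct HR as [Ss T HR | G S A D].
  - destruct HR; simpl in *; intros HG.
    + apply Forall_cons_iff in HG; apply HG.
    + apply Forall_cons_iff in HG; apply HG.
    + exact I.
    + apply Forall_app in HG. apply (HS _ (or_introl eq_refl)); apply HG.
    + destruct (HS _ (or_introl eq_refl) w HG).
    + apply Forall_cons_iff in HG; destruct HG as [HA HG].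
      apply forces_nabla in HA; destruct HA as [HA HB].
      apply (HS _ (or_introl eq_refl)); simpl.
      repeat constructor; trivial; now apply forces_nabla.
    + split; [apply (HS _ (or_introl eq_refl))
             |apply (HS _ (or_intror (or_introl eq_refl)))]; exact HG.
    + apply Forall_cons_iff in HG; destruct HG as [HA HG].
      apply forces_nabla in HA; destruct HA as [HA|HA].
      * apply (HS _ (or_introl eq_refl)); constructor; trivial.
        now apply forces_nabla.
      * apply (HS _ (or_intror (or_introl eq_refl))); constructor; trivial.
        now apply forces_nabla.
    + left; apply (HS _ (or_introl eq_refl)); exact HG.
    + right; apply (HS _ (or_introl eq_refl)); exact HG.
    + pose proof (HS _ (or_introl eq_refl) w HG) as HA; simpl in HA.
      apply Forall_cons_iff in HG; destruct HG as [HAB HG].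
      apply (HS _ (or_intror (or_introl eq_refl))); simpl.
      constructor; trivial; constructor; trivial.
      apply forces_nabla in HA; apply forces_nabla.
      apply (proj1 (forces_nabla (Datatypes.S n) _ _)) in HAB.
      exact (HAB _ (R_refl _) HA).
    + intros v Hwv HA.
      apply (HS _ (or_introl eq_refl)); simpl.
      constructor; trivial; apply Forall_map.
      eapply Forall_impl; [|exact HG]; intros c Hc; simpl.
      now apply forces_mono with w.
    + pose proof (HS _ (or_introl eq_refl) w HG) as HA; simpl in HA.
      apply Forall_cons_iff in HG; destruct HG as [HAB HG].
      apply (HS _ (or_intror (or_introl eq_refl))); simpl.
      constructor; trivial.
      apply forces_nabla in HA; apply forces_nabla in HAB; apply forces_nabla.
      exact (HAB _ (R_refl _) HA).
    + intros v Hwv HA.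
      apply (HS _ (or_introl eq_refl)); simpl.
      constructor; trivial.
      eapply Forall_impl; [|exact HG]; intros c Hc; simpl.
      now apply forces_mono with w.
    + apply (proj1 (Forall_map _ _ _)) in HG.
      pose proof (HS _ (or_introl eq_refl) (f w) HG) as HD.
      destruct D; exact HD.
  - simpl in *; intros HG; apply Forall_app in HG; destruct HG as [HG1 HG2].
    apply (HS _ (or_intror (or_introl eq_refl))); simpl.
    constructor; trivial; apply (HS _ (or_introl eq_refl)); exact HG2.
Qed.

Lemma derives_sound H S : derives iKdplus H S -> valid H -> valid S.
Proof.
  intros HS HH; induction HS as [|Ss T HR _ IH|S T [HP He] _ IH].
  - exact HH.
  - exact (rule_sound _ _ HR IH).
  - intros w HT; rewrite <- He; apply IH.
    eapply Permutation_Forall; [apply Permutation_sym; exact HP | exact HT].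
Qed.

End Semantics.

(** * Derivability as an algebra *)

Section Orders.

Context {V : Type}.
Implicit Types (a b c d x y : formula V).

(** The common form of the two implications: [m] is the identity for [Impl] and
    [Nabla] for [Arrow].  Everything below that concerns an implication is
    proved for an arbitrary residuated pair. *)
Definition residuated (le : formula V -> formula V -> Prop)
    (m : formula V -> formula V) (op : formula V -> formula V -> formula V) :=
  forall a b c, le (And (m c) a) b <-> le c (op a b).

Record nabla_algebra (le : formula V -> formula V -> Prop) : Prop := {
  le_refl : forall a, le a a;
  le_trans : forall a b c, le a b -> le b c -> le a c;
  le_top : forall a, le a Top;
  bot_le : forall a, le Bot a;
  and_le_l : forall a b, le (And a b) a;
  and_le_r : forall a b, le (And a b) b;
  le_and : forall a b c, le c a -> le c b -> le c (And a b);
  le_or_l : forall a b, le a (Or a b);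
  le_or_r : forall a b, le b (Or a b);
  or_le : forall a b c, le a c -> le b c -> le (Or a b) c;
  nabla_top : le Top (Nabla Top);
  nabla_and : forall a b, le (And (Nabla a) (Nabla b)) (Nabla (And a b));
  impl_adj : residuated le (fun c => c) (@Impl V);
  arrow_adj : residuated le (@Nabla V) (@Arrow V) }.

Section Derivable.

Variable H : sequent V.
Let D G a := derives iKdplus H (G ==> Some a).

Lemma derives_base Ss T :
  iKd Ss T -> Forall (derives iKdplus H) Ss -> derives iKdplus H T.
Proof.
  intros HR HS; eapply derives_rule; [apply iKdplus_base; exact HR|].
  now apply Forall_forall.
Qed.

Lemma derives_perm G G' a : Permutation G G' -> D G a -> D G' a.
Proof. intros HP; apply derives_mset; now split. Qed.

Lemma derives_cut G S a b : D G a -> D (a :: S) b -> D (S ++ G) b.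
Proof.
  intros Ha Hb; eapply derives_rule; [apply (Cut G S a)|].
  intros T [<-|[<-|[]]]; assumption.
Qed.

Lemma derives_weaken G S a : D G a -> D (G ++ S) a.
Proof. intros Ha; eapply derives_base; [apply LW|]; now repeat constructor. Qed.

Lemma derives_identity a : D [a] a.
Proof.
  assert (HW : forall c d, D [c] c -> D [d; c] c).
  { intros c d Hc; apply derives_perm with [c; d]; [apply perm_swap|].
    exact (derives_weaken [c] [d] c Hc). }
  induction a as [p| | |a IHa b IHb|a IHa b IHb|a IHa b IHb|a IHa b IHb|a IHa].
  - eapply derives_base; [apply Id|constructor].
  - apply (derives_weaken [] [Top]).
    eapply derives_base; [apply RTop|constructor].
  - eapply derives_base; [apply RW|]; repeat constructor.
    eapply derives_base; [apply LBot|constructor].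
  - eapply derives_base; [apply (LAnd 0)|]; repeat constructor; simpl.
    eapply derives_base; [apply RAnd|]; repeat constructor.
    + exact (derives_weaken [a] [b] a IHa).
    + now apply HW.
  - eapply derives_base; [apply (LOr 0)|]; repeat constructor; simpl.
    + eapply derives_base; [apply ROr1|]; now repeat constructor.
    + eapply derives_base; [apply ROr2|]; now repeat constructor.
  - eapply derives_base; [apply RImpl|]; repeat constructor.
    apply derives_perm with [Impl a b; a]; [apply perm_swap|].
    eapply derives_base; [apply (LImpl 0)|]; repeat constructor; simpl.
    + now apply HW.
    + exact (derives_weaken [b] [a] b IHb).
  - eapply derives_base; [apply RArrow|]; repeat constructor; simpl.
    apply derives_perm with [Nabla (Arrow a b); a]; [apply perm_swap|].
    eapply derives_base; [apply (LArrow 0)|]; repeat constructor; simpl.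
    + now apply HW.
    + apply HW with (d := Nabla (Arrow a b)) in IHb.
      exact (derives_weaken [Nabla (Arrow a b); b] [a] b IHb).
  - eapply derives_base; [apply (N [a] (Some a))|]; now repeat constructor.
Qed.

Lemma derives_trans a b c : D [a] b -> D [b] c -> D [a] c.
Proof. exact (derives_cut [a] [] b c). Qed.

Lemma derives_and_join c d b : D [c; d] b -> D [And c d] b.
Proof.
  intros Hb; eapply derives_base; [apply (LAnd 0)|]; now repeat constructor.
Qed.

Lemma derives_and_split c d b : D [And c d] b -> D [c; d] b.
Proof.
  apply (derives_cut [c; d] []).
  eapply derives_base; [apply RAnd|]; repeat constructor.
  - exact (derives_weaken [c] [d] c (derives_identity c)).
  - apply derives_perm with [d; c]; [apply perm_swap|].
    exact (derives_weaken [d] [c] d (derives_identity d)).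
Qed.

(** The two directions of residuation are the right rule and the left rule of
    the implication, each combined with a cut. *)
Lemma derives_algebra : nabla_algebra (fun a b => D [a] b).
Proof.
  pose proof derives_identity as Hid.
  split; intros.
  - apply Hid.
  - eapply derives_trans; eassumption.
  - apply (derives_weaken [] [a]).
    eapply derives_base; [apply RTop|constructor].
  - eapply derives_base; [apply RW|]; repeat constructor.
    eapply derives_base; [apply LBot|constructor].
  - apply derives_and_join; exact (derives_weaken [a] [b] a (Hid a)).
  - apply derives_and_join; apply derives_perm with [b; a]; [apply perm_swap|].
    exact (derives_weaken [b] [a] b (Hid b)).
  - eapply derives_base; [apply RAnd|]; now repeat constructor.
  - eapply derives_base; [apply ROr1|]; repeat constructor; apply Hid.
  - eapply derives_base; [apply ROr2|]; repeat constructor; apply Hid.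
  - eapply derives_base; [apply (LOr 0)|]; now repeat constructor.
  - apply (derives_weaken [] [Top]).
    eapply derives_base; [apply (N [] (Some Top))|]; repeat constructor.
    eapply derives_base; [apply RTop|constructor].
  - apply derives_and_join.
    eapply derives_base; [apply (N [a; b] (Some (And a b)))|].
    repeat constructor; apply derives_and_split, Hid.
  - intros a b c; split; intros Hc.
    + eapply derives_base; [apply RImpl|]; repeat constructor.
      apply derives_perm with [c; a]; [apply perm_swap|].
      now apply derives_and_split.
    + apply derives_and_join; apply derives_perm with [a; c]; [apply perm_swap|].
      apply (derives_cut [c] [a] (Impl a b)); [exact Hc|].
      eapply derives_base; [apply (LImpl 0)|]; repeat constructor; simpl.
      * apply derives_perm with [a; Impl a b]; [apply perm_swap|].
        exact (derives_weaken [a] [Impl a b] a (Hid a)).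
      * exact (derives_weaken [b] [a] b (Hid b)).
  - intros a b c; split; intros Hc.
    + eapply derives_base; [apply RArrow|]; repeat constructor; simpl.
      apply derives_perm with [Nabla c; a]; [apply perm_swap|].
      now apply derives_and_split.
    + apply derives_and_join.
      apply derives_perm with [a; Nabla c]; [apply perm_swap|].
      apply (derives_cut [Nabla c] [a] (Nabla (Arrow a b))).
      * eapply derives_base; [apply (N [c] (Some (Arrow a b)))|].
        now repeat constructor.
      * eapply derives_base; [apply (LArrow 0)|]; repeat constructor; simpl.
        -- apply derives_perm with [a; Nabla (Arrow a b)]; [apply perm_swap|].
           exact (derives_weaken [a] [Nabla (Arrow a b)] a (Hid a)).
        -- apply derives_perm with [b; Nabla (Arrow a b); a]; [apply perm_swap|].
           exact (derives_weaken [b] [Nabla (Arrow a b); a] b (Hid b)).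
Qed.

Lemma derives_from_top a : D [Top] a <-> D [] a.
Proof.
  split; [|exact (derives_weaken [] [Top] a)].
  apply (derives_cut [] [] Top).
  eapply derives_base; [apply RTop|constructor].
Qed.

End Derivable.

Lemma derives_change_hyp (H H' S : sequent V) :
  derives iKdplus H' H -> derives iKdplus H S -> derives iKdplus H' S.
Proof.
  intros HH HS; induction HS as [|Ss T HR _ IH|S T He _ IH].
  - exact HH.
  - now apply derives_rule with Ss.
  - now apply derives_mset with S.
Qed.

(** For a set closed under conjunction, a single member replaces a finite list of
    assumptions. *)
Definition theory_le (T : formula V -> Prop) a b : Prop :=
  exists c, T c /\ derives iKdplus ([] ==> Some c) ([a] ==> Some b).

Lemma theory_algebra (T : formula V -> Prop) :
  T Top -> (forall c d, T c -> T d -> T (And c d)) ->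
  nabla_algebra (theory_le T).
Proof.
  intros HT Hand.
  pose proof (fun c => derives_algebra ([] ==> Some c)) as HA.
  assert (Hand_hyp : forall c d,
    derives iKdplus ([] ==> Some (And c d)) ([Top] ==> Some (And c d))).
  { intros c d; apply derives_from_top; constructor. }
  (* The orders of the members of T form a directed family, so the axioms,
     each of which has finitely many premises, pass to the union. *)
  assert (Hl : forall c d a b, derives iKdplus ([] ==> Some c) ([a] ==> Some b) ->
    derives iKdplus ([] ==> Some (And c d)) ([a] ==> Some b)).
  { intros c d a b; apply derives_change_hyp, derives_from_top.
    exact (le_trans _ (HA _) _ _ _ (Hand_hyp c d) (and_le_l _ (HA _) c d)). }
  assert (Hr : forall c d a b, derives iKdplus ([] ==> Some d) ([a] ==> Some b) ->
    derives iKdplus ([] ==> Some (And c d)) ([a] ==> Some b)).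
  { intros c d a b; apply derives_change_hyp, derives_from_top.
    exact (le_trans _ (HA _) _ _ _ (Hand_hyp c d) (and_le_r _ (HA _) c d)). }
  split.
  - intros a; exists Top; split; [trivial | apply HA].
  - intros a b e (c & Hc & H1) (d & Hd & H2); exists (And c d); split; [auto|].
    apply (le_trans _ (HA _) _ b); [now apply Hl|now apply Hr].
  - intros a; exists Top; split; [trivial | apply HA].
  - intros a; exists Top; split; [trivial | apply HA].
  - intros a b; exists Top; split; [trivial | apply HA].
  - intros a b; exists Top; split; [trivial | apply HA].
  - intros a b e (c & Hc & H1) (d & Hd & H2); exists (And c d); split; [auto|].
    apply HA; [now apply Hl|now apply Hr].
  - intros a b; exists Top; split; [trivial | apply HA].
  - intros a b; exists Top; split; [trivial | apply HA].
  - intros a b e (c & Hc & H1) (d & Hd & H2); exists (And c d); split; [auto|].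
    apply HA; [now apply Hl|now apply Hr].
  - exists Top; split; [trivial | apply HA].
  - intros a b; exists Top; split; [trivial | apply HA].
  - intros a b e; split; intros (c & Hc & H1); exists c; split; trivial;
      now apply (impl_adj _ (HA c)).
  - intros a b e; split; intros (c & Hc & H1); exists c; split; trivial;
      now apply (arrow_adj _ (HA c)).
Qed.

(** * Prime filters *)

Section Filters.

Variable le : formula V -> formula V -> Prop.
Hypothesis HA : nabla_algebra le.

Record filter (w : formula V -> Prop) : Prop := {
  filter_top : w Top;
  filter_and : forall a b, w a -> w b -> w (And a b);
  filter_up : forall a b, le a b -> w a -> w b }.

Record prime (w : formula V -> Prop) : Prop := {
  prime_filter : filter w;
  prime_bot : ~ w Bot;
  prime_or : forall a b, w (Or a b) -> w a \/ w b }.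

Lemma filter_and_iff w a b : filter w -> (w (And a b) <-> w a /\ w b).
Proof.
  intros Hw; split.
  - intros Hab; split; revert Hab; apply (filter_up _ Hw); apply HA.
  - intros [Ha Hb]; now apply filter_and.
Qed.

Lemma residuated_apply m op a b :
  residuated le m op -> le (And (m (op a b)) a) b.
Proof. intros Hres; apply Hres, HA. Qed.

Lemma residuated_mono m op a b :
  residuated le m op -> le a b -> le (m a) (m b).
Proof.
  intros Hres Hab.
  assert (H : le (And (m a) Top) (m b)).
  { apply Hres, (le_trans _ HA _ b); trivial; apply Hres, HA. }
  apply (le_trans _ HA _ (And (m a) Top)); trivial; apply HA; apply HA.
Qed.

(** The meet condition for [residual_filter]. *)
Lemma residuated_and m op c d x y :
  residuated le m op ->
  le (And (op c x) (op d y)) (op (And c d) (And x y)).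
Proof.
  intros Hres; apply Hres.
  assert (Hk : forall z e, le (And (op c x) (op d y)) (op e z) ->
    le (And c d) e -> le (And (m (And (op c x) (op d y))) (And c d)) z).
  { intros z e Hz He; apply (le_trans _ HA _ (And (m (op e z)) e));
      [|now apply residuated_apply].
    apply (le_and _ HA); eapply (le_trans _ HA).
    - apply (and_le_l _ HA).
    - now apply residuated_mono with op.
    - apply (and_le_r _ HA).
    - exact He. }
  apply (le_and _ HA); [apply (Hk x c)|apply (Hk y d)]; apply HA.
Qed.

(** When [U] is closed under conjunction, this is the filter generated by [U] and
    the image of [w] under [m], where [m] and [op] are residuated; membership in
    it is read off from [w] itself.  It serves to extend a filter by new members
    ([m] the identity) and to find a world whose image under the map of the
    model lies above a given one ([m] equal to [Nabla]). *)
Definition residual_filter (op : formula V -> formula V -> formula V)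
    (U w : formula V -> Prop) x : Prop :=
  exists c, U c /\ w (op c x).

Lemma residual_filter_unit m op (U w : formula V -> Prop) :
  residuated le m op -> filter w -> U Top ->
  forall c, w c -> residual_filter op U w (m c).
Proof.
  intros Hres Hw HU c Hc; exists Top; split; trivial.
  apply (filter_up _ Hw c); trivial; apply Hres, HA.
Qed.

Lemma residual_filter_base m op (U w : formula V -> Prop) :
  residuated le m op -> filter w ->
  forall c, U c -> residual_filter op U w c.
Proof.
  intros Hres Hw c Hc; exists c; split; trivial.
  apply (filter_up _ Hw Top); [apply Hres, HA | apply Hw].
Qed.

Lemma residual_filter_filter m op (U w : formula V -> Prop) :
  residuated le m op -> filter w ->
  (exists c, U c) -> (forall c d, U c -> U d -> U (And c d)) ->
  filter (residual_filter op U w).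
Proof.
  intros Hres Hw [c0 Hc0] HU; split.
  - exists c0; split; trivial.
    apply (filter_up _ Hw Top); [apply Hres, HA | apply Hw].
  - intros x y (c & Hc & Hx) (d & Hd & Hy); exists (And c d); split; auto.
    apply (filter_up _ Hw (And (op c x) (op d y))).
    + now apply residuated_and with m.
    + now apply filter_and.
  - intros x y Hxy (c & Hc & Hx); exists c; split; trivial.
    revert Hx; apply (filter_up _ Hw), Hres.
    eapply le_trans; [exact HA|now apply residuated_apply|exact Hxy].
Qed.

(** The prime filter theorem, for an ideal given by a set of generators that is
    closed under disjunction.  A maximal filter [w] that avoids [I] is prime: if
    [a] and [b] were both outside, maximality would put some [Impl a i] and
    [Impl b j] into [w] with [i] and [j] in [I], and [Or a b] in [w] would yield
    [Or i j]. *)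
Lemma prime_filter_exists (F I : formula V -> Prop) :
  filter F -> I Bot ->
  (forall i j, I i -> I j -> I (Or i j)) ->
  (forall i, F i -> ~ I i) ->
  exists w, prime w /\ (forall a, F a -> w a) /\ (forall i, w i -> ~ I i).
Proof.
  intros HF HIb HIor HFI.
  (* The union of the empty chain is empty, hence not a filter, so Zorn's lemma
     is applied to the property that holds of the empty set as well. *)
  pose (good := fun X : formula V -> Prop =>
    filter X /\ (forall a, F a -> X a) /\ (forall i, X i -> ~ I i)).
  destruct (@classical_sets.Zorn_bigcup (formula V)
    (fun X => (exists a, X a) -> good X)) as (w & Hw & Hmax).
  { intros C HC Htot [a0 [X0 CX0 HX0]].
    pose proof (HC X0 CX0 (ex_intro _ _ HX0)) as ([H1 H2 H3] & H4 & H5).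
    repeat split.
    - exists X0; trivial.
    - intros a b [X CX HX] [Y CY HY].
      destruct (Htot X Y CX CY) as [HXY|HYX].
      + exists Y; trivial.
        destruct (HC Y CY (ex_intro _ _ HY)) as (HYf & _).
        apply (filter_and _ HYf); [now apply HXY|exact HY].
      + exists X; trivial.
        destruct (HC X CX (ex_intro _ _ HX)) as (HXf & _).
        apply (filter_and _ HXf); [exact HX|now apply HYX].
    - intros a b Hab [X CX HX]; exists X; trivial.
      destruct (HC X CX (ex_intro _ _ HX)) as (HXf & _).
      exact (filter_up _ HXf _ _ Hab HX).
    - intros a Ha; exists X0; auto.
    - intros i [X CX HX].
      destruct (HC X CX (ex_intro _ _ HX)) as (_ & _ & HXI); now apply HXI. }
  assert (Hne : exists a, w a).
  { apply NNPP; intros Hemp; apply (Hmax F); [|intros _; now repeat split; try apply HF].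
    split; [intros a Ha; destruct Hemp; now exists a|].
    intros HFw; apply Hemp; exists Top; apply HFw, HF. }
  destruct (Hw Hne) as (Hwf & HFw & HwI).
  pose proof (impl_adj _ HA) as Hres.
  assert (Hext : forall a, ~ w a -> exists i, I i /\ w (Impl a i)).
  { intros a Ha; apply NNPP; intros Hno.
    apply (Hmax (residual_filter (@Impl V) (le a) w)).
    - split.
      + exact (residual_filter_unit _ _ (le a) w Hres Hwf (le_top _ HA a)).
      + intros Hsub; apply Ha, Hsub.
        apply (residual_filter_base _ _ (le a) w Hres Hwf), HA.
    - intros _; split; [|split].
      + apply (residual_filter_filter _ _ (le a) w Hres Hwf);
          [exists a|intros c d]; apply HA.
      + intros c Hc.
        apply (residual_filter_unit _ _ (le a) w Hres Hwf (le_top _ HA a)).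
        now apply HFw.
      + intros i (c & Hac & Hci) Hi; apply Hno; exists i; split; trivial.
        revert Hci; apply (filter_up _ Hwf), Hres.
        apply (le_trans _ HA _ (And (Impl c i) c));
          [|now apply (residuated_apply (fun c => c))].
        apply HA; [apply HA|].
        apply (le_trans _ HA _ a); [apply HA|exact Hac]. }
  exists w; split; [split|split]; trivial.
  - intros Hb; exact (HwI _ Hb HIb).
  - intros a b Hab; apply NNPP; intros Hno; apply not_or_and in Hno.
    destruct (Hext a) as (i & Hi & Hai); [tauto|].
    destruct (Hext b) as (j & Hj & Hbj); [tauto|].
    apply (HwI (Or i j)); [|auto].
    set (k := Or i j).
    assert (Hup : forall c e, le e k -> w (Impl c e) -> w (Impl c k)).
    { intros c e He; apply (filter_up _ Hwf), Hres.
      eapply le_trans; [exact HA| |exact He].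
      now apply (residuated_apply (fun c => c)). }
    assert (Hai' : w (Impl a k)) by (apply (Hup a i); [apply HA|exact Hai]).
    assert (Hbj' : w (Impl b k)) by (apply (Hup b j); [apply HA|exact Hbj]).
    set (e := And (Impl a k) (Impl b k)).
    assert (Hcase : forall c, le e (Impl c k) -> le c (Impl e k)).
    { intros c He; apply Hres.
      apply (le_trans _ HA _ (And (Impl c k) c));
        [|now apply (residuated_apply (fun c => c))].
      apply HA; [|apply HA].
      eapply (le_trans _ HA); [apply (and_le_r _ HA)|exact He]. }
    apply (filter_up _ Hwf (And (Impl e k) e));
      [now apply (residuated_apply (fun c => c))|].
    apply (filter_and _ Hwf); [|now apply (filter_and _ Hwf)].
    revert Hab; apply (filter_up _ Hwf), HA; apply Hcase, HA.
Qed.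

End Filters.

(** * Pairs of prime filters that agree on the common vocabulary *)

Definition over (P : V -> Prop) a : Prop := forall p, occurs p a -> P p.

Definition agree (P : V -> Prop) (w1 w2 : formula V -> Prop) : Prop :=
  forall c, over P c -> (w1 c <-> w2 c).

Lemma agree_sym P w1 w2 : agree P w1 w2 -> agree P w2 w1.
Proof. intros H c Hc; symmetry; now apply H. Qed.

Lemma over_and P a b : over P (And a b) <-> over P a /\ over P b.
Proof. unfold over; simpl; firstorder. Qed.

(** The prime filter [v2] contains the images of [w2] and the common formulas of
    [v1], and it omits the common formulas outside [v1].  Such a filter can fail
    to exist only if some [op c d] in [w2], with common [c] in [v1] and [d]
    outside, prevents it. *)
Lemma transfer (P : V -> Prop) le1 le2 m op (v1 w2 : formula V -> Prop) :
  nabla_algebra le1 -> nabla_algebra le2 -> residuated le2 m op ->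
  prime le1 v1 -> filter le2 w2 ->
  (forall c d, over P c -> over P d -> w2 (op c d) -> v1 c -> v1 d) ->
  exists v2, prime le2 v2 /\ (forall c, w2 c -> v2 (m c)) /\ agree P v1 v2.
Proof.
  intros HA1 HA2 Hres Hv1 Hw2 Hcd.
  pose proof (prime_filter _ _ Hv1) as Hf1.
  set (U := fun c => over P c /\ v1 c).
  assert (HUT : U Top) by (split; [intros p []|apply Hf1]).
  destruct (prime_filter_exists le2 HA2 (residual_filter op U w2)
              (fun d => over P d /\ ~ v1 d)) as (v2 & Hv2 & HF & HI).
  - apply (residual_filter_filter le2 HA2 m); trivial; [now exists Top|].
    intros c d [Hc Hc'] [Hd Hd']; split; [now apply over_and|].
    now apply Hf1.
  - split; [intros p []|apply Hv1].
  - intros i j [Hi Hi'] [Hj Hj']; split.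
    + intros p [Hp|Hp]; auto.
    + intros Hij; apply (prime_or _ _ Hv1) in Hij; tauto.
  - intros d (c & [Hc Hc'] & Hw) [Hd Hd']; exact (Hd' (Hcd c d Hc Hd Hw Hc')).
  - exists v2; split; [trivial|split].
    + intros c Hc; apply HF; now apply (residual_filter_unit le2 HA2 m).
    + intros c Hc; split; intros Hvc.
      * apply HF, (residual_filter_base le2 HA2 m); trivial; now split.
      * apply NNPP; intros Hno; apply (HI c Hvc); now split.
Qed.

(** If [op a b] is missing from the first component, the usual canonical-model
    argument gives [v1]; a common formula [op c d] of [w2] belongs to [w1] by
    agreement, hence [m (op c d)] to [v1], so [transfer] applies. *)
Lemma residual_extension (P : V -> Prop) le1 le2 m op w1 w2 a b :
  nabla_algebra le1 -> nabla_algebra le2 ->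
  residuated le1 m op -> residuated le2 m op ->
  (forall c d, over P c -> over P d -> over P (op c d)) ->
  prime le1 w1 -> prime le2 w2 -> agree P w1 w2 -> ~ w1 (op a b) ->
  exists v1 v2, prime le1 v1 /\ prime le2 v2 /\ agree P v1 v2 /\
    (forall c, w1 c -> v1 (m c)) /\ (forall c, w2 c -> v2 (m c)) /\
    v1 a /\ ~ v1 b.
Proof.
  intros HA1 HA2 Hres1 Hres2 Hop Hw1 Hw2 Hag Hab.
  pose proof (prime_filter _ _ Hw1) as Hf1.
  pose proof (prime_filter _ _ Hw2) as Hf2.
  destruct (prime_filter_exists le1 HA1 (residual_filter op (le1 a) w1)
              (fun d => le1 d b)) as (v1 & Hv1 & HF & HI).
  - apply (residual_filter_filter le1 HA1 m); trivial; [exists a; apply HA1|].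
    intros c d; apply HA1.
  - apply HA1.
  - intros i j; apply HA1.
  - intros d (c & Hac & Hcd) Hdb; apply Hab.
    revert Hcd; apply (filter_up _ _ Hf1), Hres1.
    eapply (le_trans _ HA1); [|exact Hdb].
    eapply (le_trans _ HA1); [|now apply (residuated_apply le1 HA1 m op c)].
    apply HA1; [apply HA1|]; apply (le_trans _ HA1 _ a); [apply HA1|exact Hac].
  - assert (Hm : forall c, w1 c -> v1 (m c)).
    { intros c Hc; apply HF; apply (residual_filter_unit le1 HA1 m); trivial.
      apply HA1. }
    destruct (transfer P le1 le2 m op v1 w2) as (v2 & Hv2 & Hm2 & Hag2); trivial.
    { intros c d Hc Hd Hcd Hvc.
      apply Hag, Hm in Hcd; [|now apply Hop].
      apply (filter_up _ _ (prime_filter _ _ Hv1) (And (m (op c d)) c));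
        [now apply (residuated_apply le1 HA1 m)|].
      now apply (prime_filter _ _ Hv1). }
    exists v1, v2; repeat (split; trivial).
    + apply HF, (residual_filter_base le1 HA1 m); trivial; apply HA1.
    + intros Hb; apply (HI b Hb), HA1.
Qed.

(** Primeness of the preimage needs [Nabla] to preserve disjunction and falsity,
    which it does because it is a left adjoint. *)
Lemma prime_nabla le w :
  nabla_algebra le -> prime le w -> prime le (fun c => w (Nabla c)).
Proof.
  intros HA Hw; pose proof (prime_filter _ _ Hw) as Hf.
  pose proof (arrow_adj _ HA) as Hres.
  assert (Hleft : forall c d, le c (Arrow Top d) -> w (Nabla c) -> w d).
  { intros c d Hcd Hc; apply (filter_up _ _ Hf (And (Nabla c) Top)).
    - now apply Hres.
    - apply Hf; [exact Hc|apply Hf]. }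
  split; [split|..].
  - apply (filter_up _ _ Hf Top); [apply HA|apply Hf].
  - intros a b Ha Hb; apply (filter_up _ _ Hf (And (Nabla a) (Nabla b)));
      [apply HA|now apply Hf].
  - intros a b Hab; apply (filter_up _ _ Hf).
    now apply (residuated_mono le HA (@Nabla V) (@Arrow V)).
  - intros Hb; apply (prime_bot _ _ Hw); revert Hb; apply Hleft, HA.
  - intros a b Hab; apply (prime_or _ _ Hw); revert Hab.
    apply Hleft, (or_le _ HA); apply Hres;
      apply (le_trans _ HA _ _ _ (and_le_l _ HA _ _)); apply HA.
Qed.

(** The truth lemma, stated for one component of an arbitrary model so that it
    applies to both components of the amalgamated one. *)
Lemma forces_iff_mem {W : Type} (R : W -> W -> Prop) (f : W -> W) val
    (P : V -> Prop) le (t : W -> formula V -> Prop) :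
  nabla_algebra le -> (forall w, prime le (t w)) ->
  (forall w p, P p -> (val p w <-> t w (Atom p))) ->
  (forall v w c, R v w -> t v c -> t w c) ->
  (forall w c, t (f w) c <-> t w (Nabla c)) ->
  (forall w a b, ~ t w (Impl a b) -> exists v, R w v /\ t v a /\ ~ t v b) ->
  (forall w a b, ~ t w (Arrow a b) -> exists v, R w (f v) /\ t v a /\ ~ t v b) ->
  forall a w, over P a -> (forces R f val w a <-> t w a).
Proof.
  intros HA Ht Hval Hmono Hf Himpl Harrow.
  assert (Hfl : forall w, filter le (t w)) by (intros w; apply Ht).
  induction a as [p| | |a IHa b IHb|a IHa b IHb|a IHa b IHb|a IHa b IHb|a IHa];
    intros w Hov; simpl;
    try (assert (Hova : over P a) by (intros p Hp; apply Hov; simpl; tauto));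
    try (assert (Hovb : over P b) by (intros p Hp; apply Hov; simpl; tauto)).
  - apply Hval, Hov; reflexivity.
  - split; [intros _; apply Hfl|trivial].
  - split; [intros []|apply Ht].
  - rewrite IHa, IHb, (filter_and_iff le HA) by trivial; reflexivity.
  - rewrite IHa, IHb by trivial; split; [|apply Ht].
    intros [H|H]; revert H; apply (filter_up _ _ (Hfl w)), HA.
  - split.
    + intros H; apply NNPP; intros Hno.
      destruct (Himpl w a b Hno) as (v & Hwv & Ha & Hb).
      apply Hb, IHb, H; trivial; now apply IHa.
    + intros Hab v Hwv Ha; apply IHb; trivial; apply IHa in Ha; trivial.
      apply (Hmono w v) in Hab; trivial.
      apply (filter_up _ _ (Hfl v) (And (Impl a b) a));
        [apply (residuated_apply le HA _ _ _ _ (impl_adj _ HA))|now apply Hfl].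
  - split.
    + intros H; apply NNPP; intros Hno.
      destruct (Harrow w a b Hno) as (v & Hwv & Ha & Hb).
      apply Hb, IHb, H; trivial; now apply IHa.
    + intros Hab v Hwv Ha; apply IHb; trivial; apply IHa in Ha; trivial.
      apply (Hmono w (f v)), Hf in Hab; trivial.
      apply (filter_up _ _ (Hfl v) (And (Nabla (Arrow a b)) a));
        [apply (residuated_apply le HA _ _ _ _ (arrow_adj _ HA))|now apply Hfl].
  - rewrite IHa by trivial; apply Hf.
Qed.

(** * The amalgamated model *)

Section Amalgam.

Variables (P1 P2 : V -> Prop) (le1 le2 : formula V -> formula V -> Prop).
Hypotheses (HA1 : nabla_algebra le1) (HA2 : nabla_algebra le2).

Let common p := P1 p /\ P2 p.

Record world : Type := World {
  left : formula V -> Prop;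
  right : formula V -> Prop;
  left_prime : prime le1 left;
  right_prime : prime le2 right;
  left_right : agree common left right }.

Definition world_le (v w : world) : Prop :=
  (forall c, left v c -> left w c) /\ (forall c, right v c -> right w c).

Definition world_next (w : world) : world :=
  World _ _ (prime_nabla le1 _ HA1 (left_prime w))
    (prime_nabla le2 _ HA2 (right_prime w))
    (fun c Hc => left_right w (Nabla c) Hc).

(** On a common atom both disjuncts agree. *)
Definition world_val (p : V) (w : world) : Prop :=
  P1 p /\ left w (Atom p) \/ P2 p /\ right w (Atom p).

Lemma left_extension m op w a b :
  residuated le1 m op -> residuated le2 m op ->
  (forall c d, over common c -> over common d -> over common (op c d)) ->
  ~ left w (op a b) ->
  exists v, (forall c, left w c -> left v (m c)) /\
    (forall c, right w c -> right v (m c)) /\ left v a /\ ~ left v b.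
Proof.
  intros Hres1 Hres2 Hop Hab.
  destruct (residual_extension common le1 le2 m op (left w) (right w) a b)
    as (v1 & v2 & Hv1 & Hv2 & Hag & H); trivial; try apply w.
  now exists (World v1 v2 Hv1 Hv2 Hag).
Qed.

Lemma right_extension m op w a b :
  residuated le1 m op -> residuated le2 m op ->
  (forall c d, over common c -> over common d -> over common (op c d)) ->
  ~ right w (op a b) ->
  exists v, (forall c, left w c -> left v (m c)) /\
    (forall c, right w c -> right v (m c)) /\ right v a /\ ~ right v b.
Proof.
  intros Hres1 Hres2 Hop Hab.
  destruct (residual_extension common le2 le1 m op (right w) (left w) a b)
    as (v2 & v1 & Hv2 & Hv1 & Hag & H2 & H1 & H); trivial;
    try apply agree_sym; try apply w.
  now exists (World v1 v2 Hv1 Hv2 (agree_sym _ _ _ Hag)).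
Qed.

Lemma over_impl P c d : over P c -> over P d -> over P (Impl c d).
Proof. intros Hc Hd p [Hp|Hp]; auto. Qed.

Lemma over_arrow P c d : over P c -> over P d -> over P (Arrow c d).
Proof. intros Hc Hd p [Hp|Hp]; auto. Qed.

Lemma forces_left a w :
  over P1 a -> (forces world_le world_next world_val w a <-> left w a).
Proof.
  apply (forces_iff_mem world_le world_next world_val P1 le1 left); trivial.
  - apply left_prime.
  - intros u p Hp; unfold world_val; split; [|tauto].
    intros [[_ H]|[Hp2 H]]; trivial.
    apply (left_right u); trivial; intros q Hq; simpl in Hq; subst q; now split.
  - intros u v c [H _]; apply H.
  - reflexivity.
  - intros u x y H; apply (left_extension _ _ _ _ _ (impl_adj _ HA1)
      (impl_adj _ HA2) (over_impl common)) in H.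
    destruct H as (v & H1 & H2 & H); exists v; now repeat split.
  - intros u x y H; apply (left_extension _ _ _ _ _ (arrow_adj _ HA1)
      (arrow_adj _ HA2) (over_arrow common)) in H.
    destruct H as (v & H1 & H2 & H); exists v; now repeat split.
Qed.

Lemma forces_right a w :
  over P2 a -> (forces world_le world_next world_val w a <-> right w a).
Proof.
  apply (forces_iff_mem world_le world_next world_val P2 le2 right); trivial.
  - apply right_prime.
  - intros u p Hp; unfold world_val; split; [|tauto].
    intros [[Hp1 H]|[_ H]]; trivial.
    apply (left_right u); trivial; intros q Hq; simpl in Hq; subst q; now split.
  - intros u v c [_ H]; apply H.
  - reflexivity.
  - intros u x y H; apply (right_extension _ _ _ _ _ (impl_adj _ HA1)
      (impl_adj _ HA2) (over_impl common)) in H.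
    destruct H as (v & H1 & H2 & H); exists v; now repeat split.
  - intros u x y H; apply (right_extension _ _ _ _ _ (arrow_adj _ HA1)
      (arrow_adj _ HA2) (over_arrow common)) in H.
    destruct H as (v & H1 & H2 & H); exists v; now repeat split.
Qed.

Lemma amalgam_sound H S :
  derives iKdplus H S ->
  valid world_le world_next world_val H -> valid world_le world_next world_val S.
Proof.
  apply derives_sound; unfold world_le; simpl; intros.
  - split; trivial.
  - intuition.
  - intuition.
  - unfold world_val in *; intuition.
Qed.

End Amalgam.

End Orders.

Theorem theorem19 (V : Type) (A B : formula V) :
  derives iKdplus ([] ==> Some A) ([] ==> Some B) ->
  exists C : formula V,
    derives iKdplus ([] ==> Some A) ([] ==> Some C) /\
    derives iKdplus ([] ==> Some C) ([] ==> Some B) /\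
    (forall p : V, occurs p C -> occurs p A /\ occurs p B).
Proof.
  intros HAB.
  set (P1 := fun p => occurs p A); set (P2 := fun p => occurs p B).
  set (common := fun p => P1 p /\ P2 p).
  set (T := fun C => over common C /\
                     derives iKdplus ([] ==> Some A) ([] ==> Some C)).
  set (le1 := fun a b => derives iKdplus ([] ==> Some A) ([a] ==> Some b)).
  assert (HA1 : nabla_algebra le1) by apply derives_algebra.
  assert (HleT : forall C, over common C -> le1 Top C -> T C).
  { intros C HC Hle; split; [trivial|now apply derives_from_top]. }
  assert (HA2 : nabla_algebra (theory_le T)).
  { apply theory_algebra.
    - apply HleT; [intros p []|apply HA1].
    - intros c d [Hc Hc'] [Hd Hd']; apply HleT; [now apply over_and|].
      apply HA1; now apply derives_from_top. }
  apply NNPP; intros Hno.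
  (* a member of T that derives B is an interpolant *)
  assert (HB : ~ theory_le T Top B).
  { intros (C & [HC HAC] & HCB); apply Hno; exists C; split; [trivial|split].
    - now apply derives_from_top.
    - exact HC. }
  destruct (prime_filter_exists _ HA2 (theory_le T Top) (fun x => theory_le T x B))
    as (w2 & Hw2 & HF & HI).
  { split; intros; [apply HA2|now apply HA2|].
    eapply (le_trans _ HA2); eassumption. }
  { apply HA2. }
  { intros; now apply HA2. }
  { intros x Hx HxB; apply HB; eapply (le_trans _ HA2); eassumption. }
  (* The second component is completed to a world: if A derives d from c, for
     common c and d, then Impl c d is in T, so w2 contains it. *)
  destruct (transfer common (theory_le T) le1 (fun c => c) (@Impl V) w2 (le1 Top))
    as (w1 & Hw1 & _ & Hag); trivial.
  { apply HA1. }
  { split; intros; [apply HA1|now apply HA1|].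
    eapply (le_trans _ HA1); eassumption. }
  { intros c d Hc Hd Hcd Hwc.
    pose proof (prime_filter _ _ Hw2) as Hf2.
    apply (filter_up _ _ Hf2 (And (Impl c d) c));
      [apply (residuated_apply _ HA2 _ _ _ _ (impl_adj _ HA2))|].
    apply Hf2; [|exact Hwc]; apply HF.
    exists (Impl c d); split; [apply HleT; trivial; now apply over_impl|].
    apply derives_from_top; constructor. }
  set (w := World P1 P2 le1 (theory_le T) w1 w2 Hw1 Hw2 (agree_sym _ _ _ Hag)).
  apply (HI B); [|apply HA2].
  apply (forces_right P1 P2 le1 (theory_le T) HA1 HA2 B w); [now intros p|].
  apply (amalgam_sound P1 P2 le1 (theory_le T) HA1 HA2 _ _ HAB); [|constructor].
  intros u _; apply (forces_left P1 P2 le1 (theory_le T) HA1 HA2 A u); [now intros p|].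
  pose proof (prime_filter _ _ (left_prime _ _ _ _ u)) as Hf.
  apply (filter_up _ _ Hf Top); [|apply Hf].
  apply derives_from_top; constructor.
Qed.
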